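(* Let $n\ge 3$ be an integer. The symmetric group $S_n$ is a restricted GCI-group if and only if $n=3$.
   Context: For a finite group $G$, $y\in G$ and $\alpha\in\mathrm{Aut}(G)$, $y^\alpha$ denotes the image of $y$ under $\alpha$; for $S\subseteq G$, $S^\alpha=\{s^\alpha\mid s\in S\}$. Products of automorphisms act by $y^{\beta\alpha}=(y^\alpha)^\beta$. Generalized Cayley graphs: given a finite group $G$, an automorphism $\alpha\in\mathrm{Aut}(G)$ and $S\subseteq G$, suppose (a) $\alpha^2=\mathrm{id}$; (b) for every $y\in G$, $(y^{-1})^\alpha y\notin S$; (c) for all $y,h\in G$, if $(h^{-1})^\alpha y\in S$ then $(y^{-1})^\alpha h\in S$. Then $S$ is called a generalized Cayley subset of $G$ induced by $\alpha$, and $GC(G,S,\alpha)$ is the graph with vertex set $G$ and edge set $\{\{y,h\}\mid (y^{-1})^\alpha h\in S\}$. A finite group $G$ is a restricted GCI-group if for any two generalized Cayley graphs $X_i=GC(G,S_i,\alpha_i)$ $(i=1,2)$ of $G$ with both $\alpha_1$ and $\alpha_2$ of order $2$ in $\mathrm{Aut}(G)$, $X_1\cong X_2$ implies that there exist $y\in G$ and $\gamma\in\mathrm{Aut}(G)$ such that $\alpha_2=\gamma\alpha_1\gamma^{-1}$ and $S_2=y^{\alpha_2}S_1^\gamma y^{-1}$. *)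

(* Defs.v *)
From mathcomp Require Import all_boot all_fingroup.
Set Implicit Arguments.
Unset Strict Implicit.
Unset Printing Implicit Defensive.
Import GroupScope.

Record sgraph := SGraph {
  svertex :> finType;
  sedge : rel svertex;
  sedge_sym : symmetric sedge;
  sedge_irrefl : irreflexive sedge }.

Definition sgraph_iso (X Y : sgraph) : Prop :=
  exists2 f : X -> Y, bijective f & forall u v, sedge (f u) (f v) = sedge u v.

Record gcayley_subset (G : finGroupType) (S : {set G}) (alpha : {perm G})
    : Prop := GCayleySubset {
  gcayley_aut : alpha \in Aut [set: G];
  gcayley_invol : alpha ^+ 2 = 1;
  gcayley_irrefl : forall y : G, alpha y^-1 * y \notin S;
  gcayley_sym : forall y h : G, alpha h^-1 * y \in S -> alpha y^-1 * h \in S }.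

Definition gcayley_adj (G : finGroupType) (S : {set G}) (alpha : {perm G}) :
    rel G :=
  fun y h => alpha y^-1 * h \in S.

Lemma gcayley_adj_sym (G : finGroupType) (S : {set G}) (alpha : {perm G}) :
  gcayley_subset S alpha -> symmetric (gcayley_adj S alpha).
Proof. by case=> _ _ _ symS y h; apply/idP/idP; apply: symS. Qed.

Lemma gcayley_adj_irrefl (G : finGroupType) (S : {set G}) (alpha : {perm G}) :
  gcayley_subset S alpha -> irreflexive (gcayley_adj S alpha).
Proof. by case=> _ _ irrS _ y; apply/negbTE/irrS. Qed.

Definition GC (G : finGroupType) (S : {set G}) (alpha : {perm G})
    (gcS : gcayley_subset S alpha) : sgraph :=
  SGraph (gcayley_adj_sym gcS) (gcayley_adj_irrefl gcS).

(* Permutations multiply left to right here, whereas automorphisms usually    *)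
(* compose right to left: the map gamma o alpha1 o gamma^-1 is the product    *)
(* gamma^-1 * alpha1 * gamma below.                                           *)
Definition restricted_GCI (G : finGroupType) : Prop :=
  forall (S1 S2 : {set G}) (alpha1 alpha2 : {perm G})
         (gcS1 : gcayley_subset S1 alpha1) (gcS2 : gcayley_subset S2 alpha2),
    #[alpha1] = 2 -> #[alpha2] = 2 ->
    sgraph_iso (GC gcS1) (GC gcS2) ->
  exists y : G, exists2 gamma : {perm G}, gamma \in Aut [set: G] &
    alpha2 = gamma^-1 * alpha1 * gamma /\
    S2 = [set alpha2 y * gamma s * y^-1 | s in S1].

(* Main.v *)
(* In [S_n] with [n >= 4], for the conjugation by [t = (0 1)] the subsets     *)
(* [{t}] and [{u}], with [u = (2 3)], both give perfect matchings; right      *)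
(* multiplication of the odd permutations by [t u] carries one to the other.  *)
(* If they were equivalent under [y] and [gamma], commutation of [gamma] with *)
(* the conjugation by [t] would make [gamma t] act by conjugation like [t],   *)
(* whereas equivalence would force [gamma t = u].                             *)
(* In [S_3] an involutive automorphism is conjugation by a transposition [t], *)
(* and a generalized Cayley subset is [t T] with [T] an inverse-closed set of *)
(* even permutations; such a [T] is determined by its cardinal, which is the  *)
(* valency of the graph, and is invariant under conjugation.                  *)
Require Import Defs.
From mathcomp Require Import all_boot all_fingroup all_solvable.
Set Implicit Arguments.
Unset Strict Implicit.
Unset Printing Implicit Defensive.
Import GroupScope.

(** For n = 3, everything is controlled by A_3, of order 3. An automorphism of order 2 inverts A_3
    and fixes a transposition t, hence is conjugation by t ([S3_aut2_conj]). A generalized Cayley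
    subset S then avoids A_3, and t S is an inverse-closed subset of A_3, determined by its cardinal
    ([S3_inverse_closed_card]). Isomorphic graphs have the same valency, hence the same set T = t1
    S1 = t2 S2; an even g with t1 ^ g = t2 centralizes T, so conjugation by g carries S1 to S2 and y
    = 1 suffices.

    For n > 3, two disjoint transpositions give isomorphic but inequivalent graphs
    ([not_restricted_GCI_perm]). *)

Section Automorphisms.

(** * Automorphisms of a group, and the valency of its generalized Cayley graphs *)

Variable G : finGroupType.
Implicit Types (alpha : {perm G}) (S : {set G}).

Lemma autT_M alpha : alpha \in Aut [set: G] -> {morph alpha : x y / x * y}.
Proof. by move=> aA x y; apply: (morphicP (Aut_morphic aA)). Qed.

Lemma autT_1 alpha : alpha \in Aut [set: G] -> alpha 1 = 1.
Proof. by move=> aA; apply: (mulgI (alpha 1)); rewrite -autT_M ?mulg1. Qed.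

Lemma autT_V alpha : alpha \in Aut [set: G] -> {morph alpha : x / x^-1}.
Proof.
by move=> aA x; apply: (mulgI (alpha x)); rewrite -autT_M ?mulgV ?autT_1.
Qed.

Lemma conjg_self (x : G) : x ^ x = x.
Proof. by rewrite conjgE mulKg. Qed.

Lemma conj_autT (t x : G) : conj_aut [set: G] t x = x ^ t.
Proof. by rewrite norm_conj_autE ?in_setT // (subsetP (normG _)) ?in_setT. Qed.

Lemma conj_autT_Aut (t : G) : conj_aut [set: G] t \in Aut [set: G].
Proof. exact: Aut_aut. Qed.

Lemma order2_neq1 (x : G) : #[x] = 2 -> x ^+ 2 = 1 /\ x <> 1.
Proof.
move=> ox; split; first by rewrite -ox expg_order.
by move=> x1; rewrite x1 order1 in ox.
Qed.

(** This is the symmetry of the edge between 1 and s. *)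
Lemma gcayley_subset_twist S alpha s :
  gcayley_subset S alpha -> s \in S -> alpha s^-1 \in S.
Proof.
case=> aA _ _ symS sS; rewrite -[alpha _]mulg1; apply: symS.
by rewrite invg1 autT_1 ?mul1g.
Qed.

(** The neighbourhood of y is a left translate of S. *)
Lemma card_gcayley_nbhd S alpha (y : G) :
  #|[set h | gcayley_adj S alpha y h]| = #|S|.
Proof.
rewrite -(card_lcoset S (alpha y^-1)^-1); apply: eq_card => h.
by rewrite inE mem_lcoset invgK.
Qed.

Lemma gcayley_iso_card S1 S2 alpha1 alpha2
    (gcS1 : gcayley_subset S1 alpha1) (gcS2 : gcayley_subset S2 alpha2) :
  sgraph_iso (GC gcS1) (GC gcS2) -> #|S1| = #|S2|.
Proof.
case=> f bij_f fE; have inj_f := bij_inj bij_f.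
rewrite -(card_gcayley_nbhd S1 alpha1 1).
rewrite -(card_gcayley_nbhd S2 alpha2 (f (1 : G))).
rewrite -(card_imset _ inj_f); apply: eq_card => h; case: bij_f => g fK gK.
apply/imsetP/idP => [[x xP ->]|hP].
  by move: xP; rewrite !inE => xP; rewrite [gcayley_adj _ _ _ _]fE.
exists (g h); last by rewrite gK.
by move: hP; rewrite !inE -{1}[h]gK [gcayley_adj _ _ _ _]fE.
Qed.

End Automorphisms.

(** * Computations in S_3 by parity *)

Lemma S3_sqr_or_cube (p : 'S_3) : p ^+ 2 = 1 \/ p ^+ 3 = 1.
Proof.
have [p2|p2] := eqVneq (p ^+ 2) 1; [by left | right].
have [x px] : exists x, p (p x) != x.
  apply/existsP; apply: contraNT p2; rewrite negb_exists => /forallP h.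
  by apply/eqP/permP=> x; rewrite permM perm1; apply/eqP; rewrite -[_ == _]negbK h.
have npx : p x != x by apply: contraNN px => /eqP pxx; rewrite !pxx.
(* The orbit of x has three distinct points, so it is everything and p is a 3-cycle. *)
have allx y : y \in [:: x; p x; p (p x)].
  have u : uniq [:: x; p x; p (p x)].
    by rewrite /= !inE negb_or eq_sym npx eq_sym px (inj_eq perm_inj) eq_sym npx.
  have /eqP/setP/(_ y) : [set z in [:: x; p x; p (p x)]] == [set: 'I_3].
    by rewrite eqEcard subsetT cardsT card_ord cardsE (card_uniqP u).
  by rewrite inE in_setT.
have pppx : p (p (p x)) = x.
  have := allx (p (p (p x))); rewrite !inE !(inj_eq perm_inj).
  by rewrite (negPf px) (negPf npx) !orbF => /eqP.
apply/permP=> y; rewrite !expgS expg0 mulg1 !permM perm1.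
by have := allx y; rewrite !inE => /or3P[] /eqP->; rewrite ?pppx.
Qed.

Lemma S3_odd_sqr (t : 'S_3) : odd_perm t -> t * t = 1.
Proof.
move=> ot; have [//|t3] := S3_sqr_or_cube t.
by have := congr1 (@odd_perm _) t3; rewrite !expgS expg0 !odd_permM odd_perm1 ot.
Qed.

Lemma S3_odd_inv (t : 'S_3) : odd_perm t -> t^-1 = t.
Proof. by move=> ot; apply: (mulgI t); rewrite mulgV S3_odd_sqr. Qed.

(** Both t and t e are odd, hence involutions: (t e)(t e) = 1. *)
Lemma S3_conj_even (t e : 'S_3) : odd_perm t -> ~~ odd_perm e -> e ^ t = e^-1.
Proof.
move=> ot ee; have ote : odd_perm (t * e) by rewrite odd_permM ot (negPf ee).
apply: (mulIg e); rewrite mulVg conjgE S3_odd_inv //.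
by rewrite -[RHS](S3_odd_sqr ote) !mulgA.
Qed.

Lemma card_Alt3 : #|'Alt_('I_3)| = 3.
Proof.
by apply/eqP; rewrite -(eqn_pmul2l (isT : 0 < 2)) card_Alt card_ord.
Qed.

Lemma S3_even_cube (e : 'S_3) : ~~ odd_perm e -> e * e = e^-1.
Proof.
move=> ee; apply: (mulIg e); rewrite mulVg.
have eE : e \in 'Alt_('I_3) by rewrite Alt_even.
by have := expg_cardG eE; rewrite card_Alt3 !expgS expg0 mulg1 mulgA.
Qed.

Lemma S3_even_three (r e : 'S_3) :
  ~~ odd_perm r -> r != 1 -> ~~ odd_perm e -> [|| e == 1, e == r | e == r^-1].
Proof.
move=> er r1 ee.
have rV : r != r^-1.
  by rewrite -S3_even_cube // -{1}[r]mulg1 (inj_eq (mulgI r)) eq_sym.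
have u : uniq [:: 1; r; r^-1].
  by rewrite /= !inE negb_or eq_sym r1 eq_sym invg_eq1 r1 rV.
have sub : [set z in [:: 1; r; r^-1]] \subset 'Alt_('I_3).
  apply/subsetP=> z; rewrite inE Alt_even !inE.
  by case/or3P=> /eqP->; rewrite ?odd_permV ?odd_perm1.
have /eqP/setP/(_ e) : [set z in [:: 1; r; r^-1]] == 'Alt_('I_3).
  by rewrite eqEcard sub card_Alt3 cardsE (card_uniqP u).
by rewrite inE Alt_even ee !inE.
Qed.

Lemma S3_odd_conj (t u : 'S_3) :
  odd_perm t -> odd_perm u -> exists2 g, ~~ odd_perm g & t ^ g = u.
Proof.
move=> ot ou; pose e := t * u.
have ee : ~~ odd_perm e by rewrite odd_permM ot ou.
have tet : t * e = u by rewrite mulgA S3_odd_sqr ?mul1g.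
have et : e * t = t * e^-1.
  by rewrite -(S3_conj_even ot ee) conjgE S3_odd_inv // !mulgA S3_odd_sqr ?mul1g.
(* With e = t u, conjugating t by e^-1 gives e t e^-1 = t e^-2 = t e = u. *)
exists e^-1; first by rewrite odd_permV.
rewrite conjgE invgK mulgA et -mulgA -invMg.
by rewrite S3_even_cube // invgK.
Qed.

(** * Involutive automorphisms and generalized Cayley subsets of S_3 *)

Lemma S3_aut_even (alpha : {perm 'S_3}) (e : 'S_3) :
  alpha \in Aut [set: 'S_3] -> ~~ odd_perm e -> ~~ odd_perm (alpha e).
Proof.
move=> aA ee; apply: contraL ee => oae; rewrite negbK.
have e2 : e * e = 1.
  by apply: (@perm_inj _ alpha); rewrite autT_M // autT_1 // S3_odd_sqr.
apply: contraLR oae => ee; move: e2; rewrite S3_even_cube //.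
by move/eqP; rewrite invg_eq1 => /eqP->; rewrite autT_1 // odd_perm1.
Qed.

Lemma S3_aut2_conj (alpha : {perm 'S_3}) :
  alpha \in Aut [set: 'S_3] -> #[alpha] = 2 ->
  exists2 t : 'S_3, odd_perm t & alpha =1 conjg^~ t.
Proof.
move=> aA /order2_neq1[a2 a1]; have aM := autT_M aA; have aV := autT_V aA.
have aK x : alpha (alpha x) = x by rewrite -permM -[alpha * alpha]/(alpha ^+ 2) a2 perm1.
pose t0 : 'S_3 := tperm ord0 ord_max.
have ot0 : odd_perm t0 by rewrite odd_tperm.
have split x : exists2 e : 'S_3, ~~ odd_perm e & x = e \/ x = t0 * e.
  have [ox|ex] := boolP (odd_perm x); last by exists x; [|left].
  exists (t0 * x); first by rewrite odd_permM ot0 ox.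
  by right; rewrite mulgA S3_odd_sqr ?mul1g.
have oat : odd_perm (alpha t0).
  by apply: contraTT ot0 => /(S3_aut_even aA); rewrite aK.
pose e0 := t0 * alpha t0.
have ee0 : ~~ odd_perm e0 by rewrite odd_permM ot0 oat.
have at0 : alpha t0 = t0 * e0 by rewrite mulgA S3_odd_sqr ?mul1g.
(* Otherwise [alpha] fixes a generator of A_3, hence all of A_3; then [alpha] being an involution
   forces e0 * e0 = 1, so e0 = 1 and [alpha] is trivial. *)
have ainv e : ~~ odd_perm e -> alpha e = e^-1.
  move=> ee; apply/eqP; apply: contra_notT a1 => nae.
  have e1 : e != 1 by apply: contraNneq nae => ->; rewrite autT_1 // invg1.
  have aee : alpha e = e.
    have := S3_even_three ee e1 (S3_aut_even aA ee).
    rewrite (negPf nae) orbF -{1}(autT_1 aA) (inj_eq perm_inj) (negPf e1) /=.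
    by move/eqP.
  have afix f : ~~ odd_perm f -> alpha f = f.
    move=> ef; have /or3P[] := S3_even_three ee e1 ef => /eqP->.
    - exact: autT_1.
    - exact: aee.
    - by rewrite aV aee.
  have e01 : e0 = 1.
    have := aK t0; rewrite at0 aM (afix e0) // at0 -mulgA S3_even_cube //.
    by move/(canRL (mulKg _)); rewrite mulVg => /eqP; rewrite invg_eq1 => /eqP.
  apply/permP=> x; rewrite perm1; have [f ef [->|->]] := split x.
    exact: afix.
  by rewrite aM at0 e01 mulg1 afix.
(* The fixed transposition: [alpha] sends it to t0 e0 e0, and e0 e0 = e0^-1. *)
have ot : odd_perm (t0 * e0^-1) by rewrite odd_permM odd_permV ot0 (negPf ee0).
have atfix : alpha (t0 * e0^-1) = t0 * e0^-1.
  by rewrite aM aV (ainv e0) // invgK at0 -mulgA S3_even_cube.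
exists (t0 * e0^-1) => // x; have [f ef xE] := split x.
have {xE} [->|[g eg ->]] :
    x = f \/ exists2 g, ~~ odd_perm g & x = t0 * e0^-1 * g.
- case: xE => ->; [by left | right; exists (e0 * f)].
    by rewrite odd_permM (negPf ee0).
  by rewrite -mulgA mulKg.
- by rewrite ainv // S3_conj_even.
- rewrite aM atfix ainv // conjMg conjg_self.
  by rewrite S3_conj_even.
Qed.

(** An even s is itself of the forbidden form: for y = s^-1, [alpha y^-1 * y] is s^-2 = s. *)
Lemma S3_gcayley_odd (S : {set 'S_3}) (alpha : {perm 'S_3}) (t : 'S_3) :
  odd_perm t -> alpha =1 conjg^~ t -> gcayley_subset S alpha ->
  {in S, forall s, odd_perm s}.
Proof.
move=> ot aE [_ _ irrS _] s; apply: contraLR => es.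
have := irrS s^-1; rewrite invgK aE S3_conj_even // -invMg S3_even_cube //.
by rewrite invgK.
Qed.

Lemma S3_inverse_closed_card (T1 T2 : {set 'S_3}) :
  {in T1, forall e, ~~ odd_perm e} -> {in T2, forall e, ~~ odd_perm e} ->
  {in T1, forall e, e^-1 \in T1} -> {in T2, forall e, e^-1 \in T2} ->
  #|T1| = #|T2| -> T1 = T2.
Proof.
pose r : 'S_3 := tperm ord0 ord_max * tperm ord0 (inord 1).
have er : ~~ odd_perm r by rewrite odd_permM !odd_tperm -!val_eqE /= inordK.
have r1 : r != 1.
  apply/eqP=> /permP/(_ ord_max); rewrite permM tpermR tpermL perm1.
  by move/(congr1 val); rewrite /= inordK.
have rV : r != r^-1.
  by rewrite -S3_even_cube // -{1}[r]mulg1 (inj_eq (mulgI r)) eq_sym.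
have TE (T : {set 'S_3}) :
    {in T, forall e, ~~ odd_perm e} -> {in T, forall e, e^-1 \in T} ->
    T = [set e in [:: 1; r; r^-1] | if e == 1 then 1 \in T else r \in T].
  move=> eT VT; apply/setP=> e; rewrite !inE.
  apply/idP/andP => [eTe | [/or3P[] /eqP->]].
  - split; first exact: S3_even_three (eT _ eTe).
    have [<- //|e1] := eqVneq e 1.
    have := S3_even_three er r1 (eT _ eTe); rewrite (negPf e1) /=.
    by case/orP=> /eqP eE; rewrite eE in eTe => //; rewrite -[r]invgK VT.
  - by rewrite eqxx.
  - by rewrite (negPf r1).
  - by rewrite invg_eq1 (negPf r1) => /VT.
(* Both membership bits can be read off the cardinal: the parity tells whether 1 lies in T. *)
have cT (T : {set 'S_3}) :
    {in T, forall e, ~~ odd_perm e} -> {in T, forall e, e^-1 \in T} ->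
    #|T| = (1 \in T) + (r \in T).*2.
  move=> eT VT; rewrite (cardsD1 1) (cardsD1 r) (cardsD1 r^-1).
  have -> : T :\ 1 :\ r :\ r^-1 = set0.
    apply/setP=> e; rewrite !inE.
    apply/and4P=> -[/negPf eV /negPf er' /negPf e1 eTe].
    by have := S3_even_three er r1 (eT _ eTe); rewrite eV er' e1.
  have rVT : (r^-1 \in T) = (r \in T).
    by apply/idP/idP => /VT; rewrite ?invgK.
  by rewrite cards0 !inE r1 invg_eq1 r1 eq_sym rV rVT addn0 addnn.
move=> eT1 eT2 VT1 VT2; rewrite !cT // => cT12.
rewrite (TE T1) // (TE T2) //; move: cT12.
by case: (1 \in T1); case: (1 \in T2); case: (r \in T1); case: (r \in T2).
Qed.

Lemma restricted_GCI_S3 : restricted_GCI 'S_3.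
Proof.
move=> S1 S2 alpha1 alpha2 gcS1 gcS2 o1 o2 /gcayley_iso_card card_S.
have [t1 ot1 a1E] := S3_aut2_conj (gcayley_aut gcS1) o1.
have [t2 ot2 a2E] := S3_aut2_conj (gcayley_aut gcS2) o2.
have [g eg t1g] := S3_odd_conj ot1 ot2.
have even_tS (S : {set 'S_3}) (alpha : {perm 'S_3}) (t : 'S_3) :
    odd_perm t -> alpha =1 conjg^~ t ->
    gcayley_subset S alpha -> {in t *: S, forall e, ~~ odd_perm e}.
  move=> ot aE gcS _ /lcosetP[s /(S3_gcayley_odd ot aE gcS) os ->].
  by rewrite odd_permM ot os.
have inv_tS (S : {set 'S_3}) (alpha : {perm 'S_3}) (t : 'S_3) :
    odd_perm t -> alpha =1 conjg^~ t ->
    gcayley_subset S alpha -> {in t *: S, forall e, e^-1 \in t *: S}.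
  move=> ot aE gcS _ /lcosetP[s /(gcayley_subset_twist gcS) sS ->].
  rewrite mem_lcoset (S3_odd_inv ot) invMg (S3_odd_inv ot).
  by move: sS; rewrite aE conjgE (S3_odd_inv ot).
have T12 : t1 *: S1 = t2 *: S2.
  apply: S3_inverse_closed_card; rewrite ?card_lcoset //.
  - exact: even_tS gcS1.
  - exact: even_tS gcS2.
  - exact: inv_tS gcS1.
  - exact: inv_tS gcS2.
(* Both e and g lie in the abelian group A_3, so e ^ g = e. *)
have conj_T e : e \in t1 *: S1 -> e ^ g \in t1 *: S1.
  move=> eT; have ee := even_tS _ _ _ ot1 a1E gcS1 _ eT.
  have [->|g1] := eqVneq g 1; first by rewrite conjg1.
  have /or3P[] := S3_even_three eg g1 ee => /eqP eE.
  - by rewrite eE conj1g -eE.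
  - by rewrite eE conjg_self -{1}eE.
  - by rewrite eE conjVg conjg_self -eE.
exists 1; exists (conj_aut [set: 'S_3] g); first exact: conj_autT_Aut.
split.
  apply: (mulgI (conj_aut [set: 'S_3] g)); rewrite !mulgA mulgV mul1g.
  by apply/permP=> x; rewrite !permM a2E a1E !conj_autT -t1g -conjJg.
apply/esym/eqP; rewrite eqEcard card_imset ?card_S ?leqnn ?andbT; last first.
  move=> x y; rewrite invg1 !mulg1 => /mulgI; exact: perm_inj.
apply/subsetP=> _ /imsetP[s sS ->].
rewrite (autT_1 (gcayley_aut gcS2)) mul1g invg1 mulg1 conj_autT.
have : (t1 * s) ^ g \in t2 *: S2 by rewrite -T12 conj_T // mem_lcoset mulKg.
by rewrite conjMg t1g mem_lcoset mulKg.
Qed.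

(** * The counterexample for n at least 4 *)

Lemma not_restricted_GCI_perm n : 3 < n -> ~ restricted_GCI 'S_n.
Proof.
case: n => [|[|[|[|n]]]] // _ GCI.
pose t : 'S_n.+4 := tperm ord0 (inord 1).
pose u : 'S_n.+4 := tperm (inord 2) (inord 3).
have ot : odd_perm t by rewrite odd_tperm -val_eqE /= inordK.
have ou : odd_perm u by rewrite odd_tperm -val_eqE /= !inordK.
have tt : t * t = 1 by rewrite tperm2.
have tu : u ^ t = u by rewrite tpermJ !tpermD // -val_eqE /= !inordK.
pose alpha := conj_aut [set: 'S_n.+4] t.
have aE x : alpha x = x ^ t by apply: conj_autT.
(* Oddness of s excludes loops, since [alpha y^-1 * y] is always even. *)
have gc s : odd_perm s -> s ^ t = s -> s^-1 = s -> gcayley_subset [set s] alpha.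
  move=> os st sV; split.
  - exact: conj_autT_Aut.
  - by apply/permP=> x; rewrite permM !aE -conjgM tt conjg1 perm1.
  - move=> y; rewrite inE; apply: contraTneq os => <-.
    by rewrite aE odd_permM odd_permJ odd_permV addbb.
  move=> y h; rewrite !inE !aE => /eqP hy; rewrite -[_ == _](inj_eq invg_inj).
  rewrite sV invMg -[_ == s](inj_eq (conjg_inj t)) st -hy conjMg !conjVg invgK.
  by rewrite -conjgM tt conjg1.
have gct : gcayley_subset [set t] alpha by apply: gc; rewrite ?conjg_self ?tpermV.
have gcu : gcayley_subset [set u] alpha by apply: gc; rewrite ?tpermV.
(* A transposition meeting both t and u: it shows that [alpha] is nontrivial, and later separates
   conjugation by t from conjugation by u. *)
pose w : 'S_n.+4 := tperm ord0 (inord 2).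
have wt : w ^ t = tperm (inord 1) (inord 2).
  by rewrite tpermJ tpermL tpermD // -val_eqE /= !inordK.
have a2 : #[alpha] = 2.
  apply: nt_prime_order => //; first exact: gcayley_invol gct.
  apply/eqP=> /permP/(_ w); rewrite aE perm1 wt => /permP/(_ ord0).
  rewrite tpermL tpermD -?val_eqE /= ?inordK // => /(congr1 val).
  by rewrite /= inordK.
have iso : sgraph_iso (GC gct) (GC gcu).
  pose x := t * u.
  have ex : ~~ odd_perm x by rewrite odd_permM ot ou.
  have xx : x * x = 1.
    have -> : x * x = u ^ t * u by rewrite conjgE tpermV !mulgA.
    by rewrite tu tperm2.
  (* The edges are y -- t y for {t} and y -- t y x for {u}. As left multiplication by t flips
     parity, twisting just the odd vertices by the involution x matches them. *)
  pose f y := if odd_perm y then y * x else y.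
  have fK : involutive f.
    move=> y; rewrite /f.
    have [oy|/negPf oy] := boolP (odd_perm y); last by rewrite oy.
    by rewrite odd_permM oy (negPf ex) -mulgA xx mulg1.
  exists f; first exact: inv_bij.
  have adjE y h s : (alpha y^-1 * h \in [set s]) = (h == t * y * (t * s)).
    rewrite inE aE conjVg -(inj_eq (mulgI (y ^ t))) mulKVg.
    by rewrite conjgE tpermV !mulgA.
  move=> y h; rewrite /= /gcayley_adj !adjE tt mulg1 -[h == _](inj_eq (inv_inj fK)).
  congr (_ == _); rewrite /f odd_permM ot.
  by case: (odd_perm y) => //=; rewrite -/x -(mulgA t) -(mulgA y) xx mulg1.
have [y [gamma gammaA [aC uE]]] := GCI _ _ _ _ gct gcu a2 a2 iso.
have gE z : gamma z ^ t = gamma z ^ gamma t.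
  have /permP/(_ z) : gamma * alpha = alpha * gamma.
    by rewrite {1}aC !mulgA mulgV mul1g.
  by rewrite !permM !aE => ->; rewrite !conjgE !(autT_M, autT_V).
have {}gE z : z ^ t = z ^ gamma t by rewrite -[z](permKV gamma) gE.
(* Since t and [gamma t] induce the same conjugation, of square 1, their product is central. *)
have yc : y * (t * gamma t) = t * gamma t * y.
  by rewrite conjgC conjgM -gE -conjgM tt conjg1.
have gtu : gamma t = u.
  move: uE; rewrite imset_set1 => /set1_inj uE; apply: (mulgI t).
  rewrite [in RHS]uE aE conjgE tpermV !mulgA tt mul1g -[y * t * _]mulgA.
  by rewrite yc mulgK.
(* w ^ t = (1 2) moves the point 2, whereas w ^ u = (0 3) fixes it. *)
have := gE w; rewrite wt gtu tpermJ tpermL [u _]tpermD -?val_eqE /= ?inordK //.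
move=> /permP/(_ (inord 2)); rewrite tpermR tpermD -?val_eqE /= ?inordK //.
by move/(congr1 val); rewrite /= !inordK.
Qed.

Theorem theorem4p14 (n : nat) (hn : 3 <= n) :
  restricted_GCI {perm 'I_n} <-> n = 3.
Proof.
split=> [GCI | ->]; last exact: restricted_GCI_S3.
by apply/eqP; rewrite eqn_leq hn andbT leqNgt; apply/negP =>
  /not_restricted_GCI_perm.
Qed.
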